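(* Let $\Omega\subset\mathbb{R}^n$ be a bounded domain and let $u:\overline{\Omega}\times[0,T]\to\mathbb{R}$ be a smooth solution of $$\frac{\partial u}{\partial t}=F(D^2u),$$ where $F$ is a $C^2$ function defined on the cone of positive definite symmetric $n\times n$ matrices which is monotone increasing ($F(A+B)\ge F(A)$ whenever $B$ is positive definite) and such that $F^*(A)=-F(A^{-1})$ is concave on this cone. Let $\varepsilon>0$. If $D^2u\ge\varepsilon I$ everywhere on $\Omega$ at $t=0$ and on $\partial\Omega$ for $0\le t\le T$, then $D^2u\ge\varepsilon I$ everywhere on $\Omega$ for $0\le t\le T$.
   Context: $D^2u$ is the spatial Hessian of $u$; matrix inequalities are in the sense of quadratic forms. *)

(* Defs.v *)
From mathcomp Require Import all_boot all_algebra all_classical all_reals all_analysis.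
Import GRing.Theory Num.Theory.
Import numFieldNormedType.Exports.
Local Open Scope ring_scope.
Local Open Scope classical_set_scope.

Set Implicit Arguments.
Unset Strict Implicit.
Unset Printing Implicit Defensive.

Definition iter_der (R : realType) (V : normedModType R) (vs : seq V) (f : V -> R)
  : V -> R := foldr (fun v g => 'D_v g) f vs.

Definition Ck_on (R : realType) (V : normedModType R) (k : nat) (D A : set V)
  (f : V -> R) : Prop :=
  forall vs : seq V, (size vs <= k)%N -> (forall v, v \in vs -> D v) ->
    (forall x, A x -> forall v, D v -> (size vs < k)%N ->
        derivable (iter_der vs f) x v) /\
    {within A, continuous (iter_der vs f)}.

(* f is smooth (C^infinity) on A (used with A open). *)
Definition smooth_on (R : realType) (V : normedModType R) (A : set V)
  (f : V -> R) : Prop := forall k, Ck_on k setT A f.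

Definition symmat (R : realType) (n : nat) : set 'M[R]_n := [set H | H^T = H].

Definition posdef (R : realType) (n : nat) (A : 'M[R]_n) : Prop :=
  A^T = A /\ forall v : 'rV[R]_n, v != 0 -> 0 < (v *m A *m v^T) 0 0.

Definition mx_ge (R : realType) (n : nat) (A B : 'M[R]_n) : Prop :=
  forall v : 'rV[R]_n, (v *m B *m v^T) 0 0 <= (v *m A *m v^T) 0 0.

Definition Fstar (R : realType) (n : nat) (F : 'M[R]_n -> R) (A : 'M[R]_n) : R :=
  - F (invmx A).

Definition concave_on (R : realType) (n : nat) (C : set 'M[R]_n) (G : 'M[R]_n -> R)
  : Prop :=
  forall A B, C A -> C B -> forall l : R, 0 <= l <= 1 ->
    l * G A + (1 - l) * G B <= G (l *: A + (1 - l) *: B).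

Definition ebasis (R : realType) (n : nat) (i : 'I_n) : 'rV[R]_n :=
  \row_j (i == j)%:R.

Definition hess (R : realType) (n : nat) (u : 'rV[R]_n * R -> R) (p : 'rV[R]_n * R)
  : 'M[R]_n :=
  \matrix_(i, j) iter_der [:: (ebasis R i, 0 : R); (ebasis R j, 0 : R)] u p.

Definition dt (R : realType) (n : nat) (u : 'rV[R]_n * R -> R) (p : 'rV[R]_n * R) : R :=
  'D_((0 : 'rV[R]_n), (1 : R)) u p.

(* Main.v *)
Require Import Defs.
From mathcomp Require Import all_boot all_order all_algebra all_classical all_reals all_analysis.
From mathcomp Require Import ring lra.
Import Order.TTheory GRing.Theory Num.Theory.
Import numFieldNormedType.Exports.
Local Open Scope ring_scope.
Local Open Scope classical_set_scope.

Set Implicit Arguments.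
Unset Strict Implicit.
Unset Printing Implicit Defensive.

(* Suppose that the minimum of xi D^2u xi + delta t over unit vectors xi is below eps,
   and is attained at (x0, t0) and v; then x0 is interior and t0 > 0.  At this point
   D_t D_v D_v u <= - delta, so it suffices to show D_v D_v F(D^2u) >= 0.

   Write A(s) = D^2u(x0 + s v, t0).  Concavity of F^* at the midpoint of A(s)^-1 and
   A(-s)^-1 gives F(A(s)) + F(A(-s)) >= 2 F(P(s)), where P(s) is the harmonic mean of
   A(s) and A(-s).  By the variational description of P(s), the bound
   P(s) >= A(0) - kappa s^2 follows from a lower bound on
   (A(s)(m + s e, m + s e) + A(-s)(m - s e, m - s e)) / 2, whose s^2-coefficient is
     D_m D_m D_v D_v u / 2 + 2 D_m D_e D_v u + D_e D_e u.
   This is at least lambda |e|^2, which is the second-order minimality condition of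
   xi D^2u xi - lambda |xi|^2 along x = x0 + r m, xi = v + r e.  Monotonicity of F then
   gives F(P(s)) >= F(A(0) - 2 kappa s^2), and kappa tends to 0. *)

(** * Directional derivatives of smooth functions *)

Section Smooth.
Variables (R : realType) (V : normedModType R) (U : set V).
Implicit Types (f g : V -> R) (p v a b : V).

Lemma smooth_on_derive f v : smooth_on U f -> smooth_on U ('D_v f).
Proof.
move=> sf k vs vsk _.
(* [foldr] applies the last direction of the list first, so differentiating [f] along [v] beforehand
   amounts to appending [v], at the cost of one order. *)
have [|//|H1 H2] := sf k.+1 (rcons vs v); first by rewrite size_rcons.
have E : iter_der (rcons vs v) f = iter_der vs ('D_v f).
  by rewrite /iter_der foldr_rcons.
by rewrite E size_rcons ltnS in H1 H2; split.
Qed.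

Lemma smooth_on_derivable f p v : smooth_on U f -> U p -> derivable f p v.
Proof. by move=> sf Up; have [//|//|H _] := sf 1%N [::]; apply: H. Qed.

Hypothesis oU : open U.

Lemma smooth_on_continuous f p : smooth_on U f -> U p -> {for p, continuous f}.
Proof.
move=> sf Up; have [//|//|_ /=] := sf 0%N [::].
rewrite continuous_open_subspace//.
by apply; rewrite inE.
Qed.

Lemma is_derive_line f p v (s : R) : derivable f (p + s *: v) v ->
  is_derive s 1 (fun r => f (p + r *: v)) ('D_v f (p + s *: v)).
Proof.
have E : (fun h : R => h^-1 *: (((fun r => f (p + r *: v)) \o shift s) (h *: 1) -
    f (p + s *: v))) =
   (fun h : R => h^-1 *: ((f \o shift (p + s *: v)) (h *: v) - f (p + s *: v))).
  apply/funext => h /=; congr (_ *: (f _ - _)).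
  by rewrite [h *: 1]mulr1 scalerDl addrCA.
move=> df; apply: DeriveDef; first by rewrite /derivable E.
by rewrite /derive E.
Qed.

Lemma MVT_line f p v (h : R) : 0 < h ->
  (forall s, 0 <= s <= h -> derivable f (p + s *: v) v) ->
  exists2 s, 0 < s < h & f (p + h *: v) - f p = h * 'D_v f (p + s *: v).
Proof.
move=> h0 df.
have [||s] := @MVT R (fun r => f (p + r *: v)) (fun r => 'D_v f (p + r *: v)) _ _ h0.
- move=> s; rewrite in_itv /= => /andP[s0 sh].
  by apply: is_derive_line; apply: df; rewrite !ltW.
- apply: derivable_within_continuous => s; rewrite in_itv/= => sh.
  exact: (@ex_derive _ _ _ _ _ _ _ (is_derive_line (df _ sh))).
- by rewrite in_itv /= => sh; rewrite scale0r addr0 subr0 mulrC => E; exists s.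
Qed.

Lemma near_plane p a b (P : set V) : nbhs p P ->
  exists2 r : R, 0 < r & forall h k, `|h| <= r -> `|k| <= r -> P (p + h *: a + k *: b).
Proof.
move=> /nbhs_normP[e /= e0 He].
have c0 : 0 < `|a| + `|b| + 1 by rewrite ltr_wpDl// addr_ge0.
(* The summand 1 keeps the denominator positive when [a] and [b] both vanish. *)
exists (e / (`|a| + `|b| + 1)); first by rewrite divr_gt0.
move=> h k hr kr; apply: He => /=.
have -> : p - (p + h *: a + k *: b) = - (h *: a + k *: b).
  by rewrite -addrA opprD addrA subrr add0r.
rewrite normrN (le_lt_trans (ler_normD _ _))// !normrZ.
apply: (@le_lt_trans _ _ (e / (`|a| + `|b| + 1) * (`|a| + `|b|))).
  by rewrite mulrDr lerD// ler_wpM2r.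
by rewrite -mulrA gtr_pMr// mulrC ltr_pdivrMr// mul1r ltrDl.
Qed.

(* Two applications of the mean value theorem, first along [a] and then along [b]. *)
Lemma mixed_difference f p a b : smooth_on U f -> U p ->
  (f (p + h *: a + h *: b) - f (p + h *: a) - f (p + h *: b) + f p) / h ^+ 2
    @[h --> 0^'+] --> 'D_b ('D_a f) p.
Proof.
move=> sf Up; apply/cvgrPdist_le => e e0.
have sab := smooth_on_derive b (smooth_on_derive a sf).
have /cvgrPdist_le /(_ _ e0) cab := smooth_on_continuous sab Up.
have nU : nbhs p U by move: oU; rewrite openE; apply.
have [r r0 Hr] := near_plane a b (filterI nU cab).
near=> h.
have h0 : 0 < h by near: h; exact: nbhs_right_gt.
have hr : h <= r by near: h; exact: nbhs_right_le.
have Hin s k : 0 <= s <= h -> 0 <= k <= h -> U (p + s *: a + k *: b).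
  move=> /andP[s0 sh] /andP[k0 kh]; apply: (Hr s k _ _).1.
    by rewrite ger0_norm// (le_trans sh).
  by rewrite ger0_norm// (le_trans kh).
have Hin0 s : 0 <= s <= h -> U (p + s *: a).
  by move=> sh; rewrite -[p + _]addr0 -(scale0r b); apply: Hin => //; rewrite lexx ltW.
pose G (s : R) := f (p + h *: b + s *: a) - f (p + s *: a).
have dG s : 0 <= s <= h ->
    is_derive s 1 G ('D_a f (p + h *: b + s *: a) - 'D_a f (p + s *: a)).
  move=> sh; apply: is_deriveB.
    apply: is_derive_line; apply: smooth_on_derivable => //.
    by rewrite addrAC; apply: Hin => //; rewrite lexx ltW.
  by apply: is_derive_line; apply: smooth_on_derivable => //; exact: Hin0.
have [||s] := @MVT R G (fun s => 'D_a f (p + h *: b + s *: a) - 'D_a f (p + s *: a)) _ _ h0.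
- by move=> s; rewrite in_itv /= => /andP[s0 sh]; apply: dG; rewrite !ltW.
- apply: derivable_within_continuous => s; rewrite in_itv/= => sh.
  exact: (@ex_derive _ _ _ _ _ _ _ (dG _ sh)).
rewrite in_itv /= subr0 => /andP[s0 sh] E.
have [|k /andP[k0 kh]] := @MVT_line ('D_a f) (p + s *: a) b _ h0.
  move=> k kh; apply: smooth_on_derivable; first exact: smooth_on_derive.
  by apply: Hin; rewrite ?kh ?ltW.
rewrite addrAC => E2.
have -> : (f (p + h *: a + h *: b) - f (p + h *: a) - f (p + h *: b) + f p) / h ^+ 2 =
    'D_b ('D_a f) (p + s *: a + k *: b).
  move: E; rewrite E2 /G !scale0r !addr0 [p + h *: b + _]addrAC => E.
  apply: (@mulIf _ (h ^+ 2)); first by rewrite expf_neq0// gt_eqF.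
  rewrite divfK; last by rewrite expf_neq0// gt_eqF.
  by move: E; set x := f _; set y := f _; set z := f _; set w := f _; lra.
apply: (Hr _ _ _ _).2.
  by rewrite ger0_norm ltW// (lt_le_trans sh).
by rewrite ger0_norm ltW// (lt_le_trans kh).
Unshelve. all: by end_near. Qed.

(** The second-order quotient of [mixed_difference] is symmetric in [a] and [b], so both iterated
    derivatives are limits of the same expression. *)
Lemma derive_comm f p a b : smooth_on U f -> U p ->
  'D_a ('D_b f) p = 'D_b ('D_a f) p.
Proof.
move=> sf Up; rewrite -(cvg_lim (@Rhausdorff R) (@mixed_difference f p b a sf Up)).
apply: (cvg_lim (@Rhausdorff R)).
have := @mixed_difference f p a b sf Up; apply: cvg_trans; apply: near_eq_cvg.
near=> h; congr (_ / _).
rewrite [p + h *: a + _]addrAC.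
by rewrite -!addrA; congr (_ + _); rewrite !addrA; congr (_ + _); rewrite addrC.
Unshelve. all: by end_near. Qed.

Lemma cvg_line f p v : smooth_on U f -> U p ->
  f (p + h *: v) @[h --> 0^'+] --> f p.
Proof.
move=> sf Up; apply: (@cvg_comp _ _ _ (fun h : R => p + h *: v) f _ (nbhs p)).
  apply: cvg_at_right_filter; rewrite -[X in _ --> X]addr0 -(scale0r v).
  by apply: cvgD; [exact: cvg_cst|apply: cvgZr_tmp].
exact: smooth_on_continuous.
Qed.

Lemma difference_quotient f p v : derivable f p v ->
  (f (p + h *: v) - f p) / h @[h --> 0^'+] --> 'D_v f p.
Proof.
move=> /cvg_dnbhs_at_right.
apply: cvg_trans; apply: near_eq_cvg; near=> h.
by rewrite /= [h *: v + p]addrC [LHS]mulrC.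
Unshelve. all: by end_near. Qed.

(** The base point moves with [h]; the mean value theorem along [b] and the continuity of ['D_b f]
    at [p] control the quotient. *)
Lemma difference_quotient_shift f p a b : smooth_on U f -> U p ->
  (f (p + h *: a + h *: b) - f (p + h *: a)) / h @[h --> 0^'+] --> 'D_b f p.
Proof.
move=> sf Up; apply/cvgrPdist_le => e e0.
have /cvgrPdist_le /(_ _ e0) cb := smooth_on_continuous (smooth_on_derive b sf) Up.
have nU : nbhs p U by move: oU; rewrite openE; apply.
have [r r0 Hr] := near_plane a b (filterI nU cb).
near=> h.
have h0 : 0 < h by near: h; exact: nbhs_right_gt.
have hr : h <= r by near: h; exact: nbhs_right_le.
have Hin k : 0 <= k <= h -> (U `&` (fun q => `|'D_b f p - 'D_b f q| <= e))
    (p + h *: a + k *: b).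
  move=> /andP[k0 kh]; apply: Hr; first by rewrite gtr0_norm.
  by rewrite ger0_norm// (le_trans kh).
have [k kh|k /andP[k0 kh] ->] := @MVT_line f (p + h *: a) b _ h0.
  by apply: smooth_on_derivable => //; apply: (Hin k kh).1.
rewrite mulrC mulKf ?gt_eqF//.
by apply: (Hin k _).2; rewrite !ltW.
Unshelve. all: by end_near. Qed.

(** The increment along [a + b] is split at [p + h *: a]; its second piece has a moving base point,
    which is the case of [difference_quotient_shift]. *)
Lemma derive_dirD f p a b : smooth_on U f -> U p ->
  'D_(a + b) f p = 'D_a f p + 'D_b f p.
Proof.
move=> sf Up.
rewrite -(cvg_lim (@Rhausdorff R)
  (difference_quotient (@smooth_on_derivable f p (a + b) sf Up))).
apply: (cvg_lim (@Rhausdorff R)).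
have /(_ _) := cvgD (difference_quotient (@smooth_on_derivable f p a sf Up))
  (@difference_quotient_shift f p a b sf Up).
apply: cvg_trans; apply: near_eq_cvg; near=> h.
rewrite !fctE /= scalerDr addrA -mulrDl; congr (_ * _).
by set x := f _; set y := f _; set z := f _; ring.
Unshelve. all: by end_near. Qed.

(** The line through [p] with direction [c *: v] is the line with direction [v] reparametrized by
    multiplication by [c], so the chain rule in one variable applies. *)
Lemma derive_dirZ f p (c : R) v : smooth_on U f -> U p ->
  'D_(c *: v) f p = c * 'D_v f p.
Proof.
move=> sf Up.
have Up0 : U (p + 0 *: v) by rewrite scale0r addr0.
have Upc : U (p + 0 *: (c *: v)) by rewrite scale0r addr0.
have d1 := is_derive_line (@smooth_on_derivable f _ v sf Up0).
have d2 := is_derive_line (@smooth_on_derivable f _ (c *: v) sf Upc).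
have d3 : is_derive (0 : R) 1 ( *%R c) c.
  by apply: is_derive_eq; rewrite scaler1.
have := @derive_val _ _ _ _ _ _ _ d2.
have -> : (fun r => f (p + r *: (c *: v))) = (fun r => f (p + r *: v)) \o ( *%R c).
  by apply/funext => r /=; rewrite scalerA mulrC.
rewrite -derive1E derive1_comp//; last first.
  by rewrite mulr0; exact: (@ex_derive _ _ _ _ _ _ _ d1).
by rewrite mulr0 !derive1E !derive_val !scale0r !addr0 mulrC => <-.
Qed.

Lemma derive_dirN f p v : smooth_on U f -> U p -> 'D_(- v) f p = - 'D_v f p.
Proof. by move=> sf Up; rewrite -scaleN1r (derive_dirZ _ _ sf)// mulN1r. Qed.

Lemma derive_dir_sum f p (I : finType) (c : I -> R) (w : I -> V) :
  smooth_on U f -> U p ->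
  'D_(\sum_i c i *: w i) f p = \sum_i c i * 'D_(w i) f p.
Proof.
move=> sf Up; elim/big_ind2 : _ => [|a x b y <- <-|i _].
- exact: derive0.
- by rewrite derive_dirD// addrC.
- exact: derive_dirZ.
Qed.

(** This is [mixed_difference] for the directions [v] and [- v], whose fourth corner returns to [p],
    with the sign reversed. *)
Lemma second_difference f p v : smooth_on U f -> U p ->
  (f (p + h *: v) + f (p - h *: v) - 2 * f p) / h ^+ 2
    @[h --> 0^'+] --> 'D_v ('D_v f) p.
Proof.
move=> sf Up.
have /(_ _) := cvgN (@mixed_difference f p v (- v) sf Up).
rewrite derive_dirN//; last exact: smooth_on_derive.
rewrite opprK; apply: cvg_trans; apply: near_eq_cvg; near=> h.
rewrite !fctE /= scalerN addrK.
by set x := f _; set y := f _; set z := f _; lra.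
Unshelve. all: by end_near. Qed.

Lemma symmetric_difference f p v : smooth_on U f -> U p ->
  (f (p + h *: v) - f (p - h *: v)) / h @[h --> 0^'+] --> 2 * 'D_v f p.
Proof.
move=> sf Up.
have /(_ _) := cvgB (difference_quotient (@smooth_on_derivable f p v sf Up))
  (difference_quotient (@smooth_on_derivable f p (- v) sf Up)).
rewrite derive_dirN// opprK mulr2n mulrDl mul1r.
apply: cvg_trans; apply: near_eq_cvg; near=> h.
rewrite !fctE /= scalerN.
by set x := f _; set y := f _; set z := f _; lra.
Unshelve. all: by end_near. Qed.

Lemma symmetric_sum f p v : smooth_on U f -> U p ->
  f (p + h *: v) + f (p - h *: v) @[h --> 0^'+] --> 2 * f p.
Proof.
move=> sf Up.
have /(_ _) := cvgD (@cvg_line f p v sf Up) (@cvg_line f p (- v) sf Up).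
rewrite mulr2n mulrDl mul1r.
apply: cvg_trans; apply: near_eq_cvg; near=> h.
by rewrite !fctE /= scalerN.
Unshelve. all: by end_near. Qed.

Lemma near_line p v (P : set V) : nbhs p P ->
  \forall h \near 0^'+, P (p + h *: v) /\ P (p - h *: v).
Proof.
move=> pP; have [r r0 Hr] := near_plane v 0 pP.
near=> h.
have h0 : 0 < h by near: h; exact: nbhs_right_gt.
have hr : `|h| <= r by rewrite gtr0_norm//; near: h; exact: nbhs_right_le.
have := Hr h 0; have := Hr (- h) 0.
rewrite !scaler0 !addr0 scaleNr normrN normr0 (ltW r0) => H1 H2.
by split; [exact: H2|exact: H1].
Unshelve. all: by end_near. Qed.

(** Divide by [h ^+ 2] and let [h] tend to 0. The hypothesis has the shape of a quadratic form with
    coefficients [f], [g], [k], evaluated at two opposite points with its argument moving linearly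
    in [h]. *)
Lemma second_order_le f g k p v (c : R) :
  smooth_on U f -> smooth_on U g -> smooth_on U k -> U p ->
  (\forall h \near 0^'+, 2 * f p + h ^+ 2 * c <=
     f (p + h *: v) + f (p - h *: v) + 2 * h * (g (p + h *: v) - g (p - h *: v)) +
     h ^+ 2 * (k (p + h *: v) + k (p - h *: v))) ->
  c <= 'D_v ('D_v f) p + 2 * (2 * 'D_v g p) + 2 * k p.
Proof.
move=> sf sg sk Up H.
have cc : (f (p + h *: v) + f (p - h *: v) - 2 * f p) / h ^+ 2 +
    2 * ((g (p + h *: v) - g (p - h *: v)) / h) + (k (p + h *: v) + k (p - h *: v))
    @[h --> 0^'+] --> 'D_v ('D_v f) p + 2 * (2 * 'D_v g p) + 2 * k p.
  apply: cvgD; last exact: (@symmetric_sum k p v sk Up).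
  apply: cvgD; first exact: (@second_difference f p v sf Up).
  by apply: cvgM; [exact: cvg_cst|exact: (@symmetric_difference g p v sg Up)].
apply: (cvgr_to_ge cc); near=> h.
have h0 : 0 < h by near: h; exact: nbhs_right_gt.
have : 2 * f p + h ^+ 2 * c <=
     f (p + h *: v) + f (p - h *: v) + 2 * h * (g (p + h *: v) - g (p - h *: v)) +
     h ^+ 2 * (k (p + h *: v) + k (p - h *: v)) by near: h; exact: H.
set f1 := f (_ + _); set f2 := f (_ - _); set g1 := g (_ + _); set g2 := g (_ - _).
set k1 := k (_ + _); set k2 := k (_ - _) => Hh.
rewrite -(ler_pM2l (exprn_gt0 2 h0)).
have -> : h ^+ 2 * ((f1 + f2 - 2 * f p) / h ^+ 2 + 2 * ((g1 - g2) / h) + (k1 + k2)) =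
    f1 + f2 - 2 * f p + 2 * h * (g1 - g2) + h ^+ 2 * (k1 + k2).
  field; exact: lt0r_neq0.
by lra.
Unshelve. all: by end_near. Qed.

(** Only increments on the side of [- v] are tested; with [v] the time direction this covers a
    minimum attained at the final time. *)
Lemma derive_le_backward f p v (delta : R) :
  smooth_on U f -> U p ->
  (\forall h \near 0^'+, delta * h <= f (p - h *: v) - f p) ->
  'D_v f p <= - delta.
Proof.
move=> sf Up H.
suff : delta <= 'D_(- v) f p by rewrite (derive_dirN _ sf Up) lerNr.
apply: (cvgr_to_ge (difference_quotient (@smooth_on_derivable f p (- v) sf Up))).
near=> h.
have h0 : 0 < h by near: h; exact: nbhs_right_gt.
by rewrite scalerN ler_pdivlMr//; near: h.
Unshelve. all: by end_near. Qed.

Lemma eq_on_derive f g p v : (forall q, U q -> f q = g q) -> U p ->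
  'D_v f p = 'D_v g p.
Proof.
move=> fg Up; apply: near_eq_derive; apply: filterS fg _.
by move: oU; rewrite openE; apply.
Qed.

Lemma derive_comm3 f p a b c : smooth_on U f -> U p ->
  'D_a ('D_b ('D_c f)) p = 'D_b ('D_c ('D_a f)) p.
Proof.
move=> sf Up; apply: (etrans (@derive_comm _ p a b (smooth_on_derive c sf) Up)).
apply: (@eq_on_derive _ _ p b _ Up) => q Uq.
exact: (@derive_comm f q a c sf Uq).
Qed.

Lemma derive_comm4 f p a b c : smooth_on U f -> U p ->
  'D_a ('D_a ('D_b ('D_c f))) p = 'D_b ('D_c ('D_a ('D_a f))) p.
Proof.
move=> sf Up.
apply: (etrans _ (@derive_comm3 _ p a b c (smooth_on_derive a sf) Up)).
apply: (@eq_on_derive _ _ p a _ Up) => q Uq.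
exact: (@derive_comm3 f q a b c sf Uq).
Qed.
End Smooth.

(** * Quadratic forms and the harmonic mean *)

Definition bform (R : realType) (n : nat) (A : 'M[R]_n) (v w : 'rV[R]_n) : R :=
  (v *m A *m w^T) 0 0.

Definition sqnorm (R : realType) (n : nat) (v : 'rV[R]_n) : R := bform 1%:M v v.

Section Forms.
Variables (R : realType) (n : nat).
Implicit Types (A B C P : 'M[R]_n) (v w m d e : 'rV[R]_n) (c : R).

Lemma bformE A v w : bform A v w = \sum_i \sum_j v 0 i * w 0 j * A i j.
Proof.
rewrite /bform mxE exchange_big; apply: eq_bigr => j _.
rewrite mxE mulr_suml; apply: eq_bigr => i _.
by rewrite !mxE mulrAC.
Qed.

Lemma bform0l A v : bform A 0 v = 0.
Proof. by rewrite /bform !mul0mx mxE. Qed.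

Lemma bformDl A v1 v2 w : bform A (v1 + v2) w = bform A v1 w + bform A v2 w.
Proof. by rewrite /bform !mulmxDl mxE. Qed.

Lemma bformDr A v w1 w2 : bform A v (w1 + w2) = bform A v w1 + bform A v w2.
Proof. by rewrite /bform linearD mulmxDr mxE. Qed.

Lemma bformZl A c v w : bform A (c *: v) w = c * bform A v w.
Proof. by rewrite /bform -!scalemxAl mxE. Qed.

Lemma bformZr A c v w : bform A v (c *: w) = c * bform A v w.
Proof. by rewrite /bform linearZ -scalemxAr mxE. Qed.

Lemma bformNl A v w : bform A (- v) w = - bform A v w.
Proof. by rewrite -scaleN1r bformZl mulN1r. Qed.

Lemma bformNr A v w : bform A v (- w) = - bform A v w.
Proof. by rewrite -scaleN1r bformZr mulN1r. Qed.

Lemma bformD A B v w : bform (A + B) v w = bform A v w + bform B v w.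
Proof. by rewrite /bform mulmxDr mulmxDl mxE. Qed.

Lemma bformZ A c v w : bform (c *: A) v w = c * bform A v w.
Proof. by rewrite /bform -scalemxAr -scalemxAl mxE. Qed.

Lemma bformN A v w : bform (- A) v w = - bform A v w.
Proof. by rewrite -scaleN1r bformZ mulN1r. Qed.

Lemma bform_scalar c v : bform c%:M v v = c * sqnorm v.
Proof. by rewrite -scalemx1 bformZ. Qed.

Lemma bform_sym A v w : A^T = A -> bform A v w = bform A w v.
Proof.
move=> As; rewrite /bform -[v *m A *m _]trmxK mxE.
by rewrite !trmx_mul trmxK As mulmxA.
Qed.

Lemma sqnormE v : sqnorm v = \sum_i v 0 i ^+ 2.
Proof.
rewrite /sqnorm bformE; apply: eq_bigr => i _.
rewrite (bigD1 i)//= big1 ?addr0; first by rewrite mxE eqxx mulr1.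
by move=> j ji; rewrite mxE eq_sym (negbTE ji) mulr0.
Qed.

Lemma sqnorm_ge0 v : 0 <= sqnorm v.
Proof. by rewrite sqnormE sumr_ge0// => i _; exact: sqr_ge0. Qed.

Lemma sqnorm_gt0 v : (0 < sqnorm v) = (v != 0).
Proof.
rewrite lt_neqAle sqnorm_ge0 andbT eq_sym; congr (~~ _).
apply/eqP/eqP => [|->]; last by rewrite sqnormE big1// => i _; rewrite mxE expr0n.
rewrite sqnormE => /eqP; rewrite psumr_eq0; last by move=> i _; exact: sqr_ge0.
move=> /allP H; apply/rowP => i; rewrite mxE; apply/eqP.
by have := H i (mem_index_enum i); rewrite /= sqrf_eq0.
Qed.

Lemma posdef_bform_gt0 A v : posdef A -> v != 0 -> 0 < bform A v v.
Proof. by move=> [_]; apply. Qed.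

Lemma posdef_unitmx A : posdef A -> A \in unitmx.
Proof.
move=> pA; rewrite -row_free_unit; apply: inj_row_free => v vA0.
apply/eqP/negPn/negP => v0; have := posdef_bform_gt0 pA v0.
by rewrite /bform vA0 mul0mx mxE ltxx.
Qed.

Lemma posdef_invmx A : posdef A -> posdef (invmx A).
Proof.
move=> pA; have uA := posdef_unitmx pA; have [As _] := pA.
split; first by rewrite trmx_inv As.
move=> v v0; have w0 : v *m invmx A != 0.
  by apply: contra v0 => /eqP H; rewrite -(mulmxKV uA v) H mul0mx.
have := posdef_bform_gt0 pA w0.
by rewrite /bform mulmxKV// trmx_mul trmx_inv As mulmxA.
Qed.

Lemma posdefD A B : posdef A -> posdef B -> posdef (A + B).
Proof.
move=> pA pB; split; first by rewrite linearD /= pA.1 pB.1.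
move=> v v0; rewrite -/(bform _ _ _) bformD.
by rewrite addr_gt0//; exact: posdef_bform_gt0.
Qed.

Lemma posdefZ c A : 0 < c -> posdef A -> posdef (c *: A).
Proof.
move=> c0 pA; split; first by rewrite linearZ /= pA.1.
move=> v v0; rewrite -/(bform _ _ _) bformZ.
by rewrite mulr_gt0//; exact: posdef_bform_gt0.
Qed.

(** The weights are written as [l] and [1 - l] at [l = 1 / 2], to match [concave_on] literally. *)
Definition harmonic_mean A B := invmx ((1 / 2) *: invmx A + (1 - 1 / 2) *: invmx B).

(* The harmonic mean P is the parallel sum of A and B: P(m, m) is the infimum over
   d of (A(m + d, m + d) + B(m - d, m - d)) / 2, attained at the d chosen below. *)
Lemma le_harmonic_mean A B C : posdef A -> posdef B ->
  (forall m d, 2 * bform C m m <= bform A (m + d) (m + d) + bform B (m - d) (m - d)) ->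
  forall m, bform C m m <= bform (harmonic_mean A B) m m.
Proof.
move=> pA pB H m; rewrite /harmonic_mean; set M := _ + _.
have pM : posdef M.
  by apply: posdefD; apply: posdefZ; rewrite ?posdef_invmx//; try lra;
    exact: posdef_invmx.
have uM := posdef_unitmx pM.
pose w := m *m invmx M.
pose v1 := w *m invmx A; pose v2 := w *m invmx B.
(* This choice makes [m + d] equal to [v1] and [m - d] equal to [v2]. The right-hand side of [H]
   then becomes the sum of the inverse forms at [w], which is twice [bform M w w], hence twice the
   harmonic mean at [m]. *)
pose d := (1 / 2) *: (v1 - v2).
have mE : m = (1 / 2) *: (v1 + v2).
  rewrite -[LHS](mulmxKV uM) -/w /M mulmxDr -!scalemxAr -/v1 -/v2 scalerDr.
  by congr (_ + _ *: _); lra.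
have half (x : 'rV[R]_n) : (1 / 2) *: (x + x) = x.
  by apply/rowP => i; rewrite !mxE; lra.
have E1 : m + d = v1 by rewrite mE /d -scalerDr addrACA subrr addr0 half.
have E2 : m - d = v2 by rewrite mE /d -scalerBr opprB addrC addrA subrK half.
have iE D : posdef D -> bform D (w *m invmx D) (w *m invmx D) = bform (invmx D) w w.
  move=> pD; rewrite /bform mulmxKV ?posdef_unitmx// trmx_mul trmx_inv.
  by rewrite pD.1 mulmxA.
have := H m d; rewrite E1 E2 !iE//.
have -> : bform (invmx M) m m = bform M w w.
  by rewrite /w /bform mulmxKV// trmx_mul trmx_inv pM.1 mulmxA.
by rewrite /M bformD !bformZ; lra.
Qed.

(** Concavity of [Fstar F] at the midpoint of the inverses bounds the mean of [F A] and [F B] below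
    by [F] at the harmonic mean. That mean dominates [C] only weakly, while monotonicity of [F] asks
    for a positive definite increment; the shift by [c] supplies it. *)
Lemma harmonic_mean_F_le (F : 'M[R]_n -> R) A B C c :
  (forall A B, posdef A -> posdef B -> F A <= F (A + B)) ->
  concave_on (@posdef R n) (Fstar F) ->
  posdef A -> posdef B -> 0 < c -> posdef (C - c%:M) ->
  (forall m d, 2 * bform C m m <= bform A (m + d) (m + d) + bform B (m - d) (m - d)) ->
  2 * F (C - c%:M) <= F A + F B.
Proof.
move=> Fm Fc pA pB c0 pC H.
have := Fc _ _ (posdef_invmx pA) (posdef_invmx pB) (1 / 2).
rewrite /Fstar !invmxK -/(harmonic_mean A B) => H1.
have {}H1 := H1 ltac:(lra).
have pP : posdef (harmonic_mean A B).
  by apply: posdef_invmx; apply: posdefD; apply: posdefZ; try lra;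
    exact: posdef_invmx.
suff : F (C - c%:M) <= F (harmonic_mean A B) by lra.
rewrite -[harmonic_mean A B](subrKC (C - c%:M)); apply: Fm => //.
split; first by rewrite linearB /= pP.1 pC.1.
move=> v v0; rewrite -/(bform _ _ _).
have := le_harmonic_mean pA pB H v.
have := v0; rewrite -sqnorm_gt0 => /(mulr_gt0 c0).
by rewrite bformD bformN bformD bformN bform_scalar; lra.
Qed.
End Forms.

(** * Stability of quadratic inequalities under convergence of the coefficients *)

Section UniformForms.
Variables (R : realType) (n : nat).
Implicit Types (E : 'M[R]_n) (v w m e : 'rV[R]_n).

(** Each product of coordinates is bounded by the sum of their squares, and every square occurs [n]
    times in the double sum. *)
Lemma bform_le_entries E v w (eta : R) : (forall i j, `|E i j| <= eta) ->
  `|bform E v w| <= eta * n%:R * (sqnorm v + sqnorm w).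
Proof.
move=> HE; rewrite bformE.
have -> : eta * n%:R * (sqnorm v + sqnorm w) =
    \sum_(i < n) \sum_(j < n) eta * (v 0 i ^+ 2 + w 0 j ^+ 2).
  under eq_bigr do rewrite -mulr_sumr big_split /= sumr_const card_ord -sqnormE.
  rewrite -mulr_sumr big_split /= sumr_const card_ord sumrMnl -sqnormE.
  by rewrite -mulrnDl -[_ *+ n]mulr_natr; ring.
rewrite (le_trans (ler_norm_sum _ _ _))// ler_sum// => i _.
rewrite (le_trans (ler_norm_sum _ _ _))// ler_sum// => j _.
rewrite normrM mulrC ler_pM//.
by rewrite ler_norml; apply/andP; split; nra.
Qed.

(** The limit form is coercive in [e] but only nonnegative in [m]. A small error of the coefficients
    is absorbed by [lam] in the [e] part and by the allowed loss [kap] in the [m] part, uniformly in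
    both vectors. *)
Lemma near_forms_ge (X Y Z : R -> 'M[R]_n) (X0 Y0 Z0 : 'M[R]_n) (lam kap : R) :
  (forall i j, X h i j @[h --> 0^'+] --> X0 i j) ->
  (forall i j, Y h i j @[h --> 0^'+] --> Y0 i j) ->
  (forall i j, Z h i j @[h --> 0^'+] --> Z0 i j) ->
  0 < lam -> 0 < kap ->
  (forall m e, lam * sqnorm e <= bform X0 m m + bform Y0 m e + bform Z0 e e) ->
  \forall h \near 0^'+, forall m e,
    - kap * sqnorm m <= bform (X h) m m + bform (Y h) m e + bform (Z h) e e.
Proof.
move=> cX cY cZ l0 k0 H.
pose c := Num.min lam kap; have c0 : 0 < c by rewrite lt_min l0.
have [cl ck] : c <= lam /\ c <= kap by rewrite /c !ge_min !lexx orbT.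
(* By [bform_le_entries] the three forms together contribute an error of [3 * eta * n] to each of
   [sqnorm m] and [sqnorm e]; the summand 1 covers [n = 0]. *)
pose eta := c / (3 * n%:R + 1).
have N0 : 0 < 3 * n%:R + 1 :> R by rewrite ltr_wpDl// mulr_ge0.
have eta0 : 0 < eta by rewrite divr_gt0.
have eta_le : eta * n%:R * 3 <= c.
  by rewrite /eta -!mulrA ger_pMr// mulrC ler_pdivrMr// mul1r [_ * 3]mulrC lerDl.
have nearE (W : R -> 'M[R]_n) (W0 : 'M[R]_n) : (forall i j, W h i j @[h --> 0^'+] --> W0 i j) ->
    \forall h \near 0^'+, forall i j, `|(W0 - W h) i j| <= eta.
  move=> cW; apply: filter_forall => i; apply: filter_forall => j.
  have /cvgrPdist_le /(_ _ eta0) := cW i j.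
  by apply: filterS => h; rewrite !mxE.
near=> h => m e.
have bnd (W : R -> 'M[R]_n) (W0 : 'M[R]_n) v w : (forall i j, `|(W0 - W h) i j| <= eta) ->
    bform W0 v w <= bform (W h) v w + eta * n%:R * (sqnorm v + sqnorm w).
  move=> /(@bform_le_entries _ v w); rewrite bformD bformN => /(le_trans (ler_norm _)).
  by rewrite lerBlDl.
have EX : forall i j, `|(X0 - X h) i j| <= eta by near: h; exact: nearE.
have hX := bnd X X0 m m EX.
have EY : forall i j, `|(Y0 - Y h) i j| <= eta by near: h; exact: nearE.
have hY := bnd Y Y0 m e EY.
have EZ : forall i j, `|(Z0 - Z h) i j| <= eta by near: h; exact: nearE.
have hZ := bnd Z Z0 e e EZ.
have := H m e.
have m0 := sqnorm_ge0 m; have e0 := sqnorm_ge0 e.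
move: hX hY hZ eta_le; set N := eta * n%:R => hX hY hZ eta_le Hme.
nra.
Unshelve. all: by end_near. Qed.
End UniformForms.

(** * The Hessian along lines *)

(** Add the two inequalities: the cross terms of the norms cancel, while those of [P] and [N] leave
    a difference. *)
Lemma bform_perturbation (R : realType) (n : nat) (P N : 'M[R]_n) (v e : 'rV[R]_n)
    (lam h : R) : P^T = P -> N^T = N ->
  lam * sqnorm (v + h *: e) <= bform P (v + h *: e) (v + h *: e) ->
  lam * sqnorm (v - h *: e) <= bform N (v - h *: e) (v - h *: e) ->
  2 * (lam * sqnorm v) + h ^+ 2 * (2 * (lam * sqnorm e)) <=
    bform P v v + bform N v v + 2 * h * (bform P e v - bform N e v) +
    h ^+ 2 * (bform P e e + bform N e e).
Proof.
move=> S1 S2; rewrite /sqnorm !(bformDl, bformDr, bformZl, bformZr, bformNl, bformNr).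
rewrite (bform_sym v e S1) (bform_sym v e S2) (bform_sym v e (trmx1 _ _)).
move: (bform P v v) (bform N v v) (bform P e v) (bform N e v) (bform P e e)
  (bform N e e) (bform 1%:M v v) (bform 1%:M e v) (bform 1%:M e e).
by move=> q1 q2 q3 q4 q5 q6 q7 q8 q9; lra.
Qed.

Definition spatial (R : realType) (n : nat) (w : 'rV[R]_n) : 'rV[R]_n * R := (w, 0).

Section Hessian.
Variables (R : realType) (n : nat) (U : set ('rV[R]_n * R)) (u : 'rV[R]_n * R -> R).
Hypotheses (oU : open U) (su : smooth_on U u).
Implicit Types (p : 'rV[R]_n * R) (v w m e : 'rV[R]_n) (f : 'rV[R]_n * R -> R).

Lemma spatial_ebasis w : spatial w = \sum_i w 0 i *: spatial (ebasis R i).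
Proof.
rewrite /spatial [LHS]surjective_pairing [RHS]surjective_pairing; congr (_, _).
  rewrite (raddf_sum fst) [LHS]row_sum_delta; apply: eq_bigr => i _ /=.
  congr (_ *: _); apply/rowP => j; rewrite !mxE.
  by rewrite eq_sym.
by rewrite (raddf_sum snd) big1// => i _ /=; rewrite scaler0.
Qed.

Lemma derive_spatial f p w : smooth_on U f -> U p ->
  'D_(spatial w) f p = \sum_i w 0 i * 'D_(spatial (ebasis R i)) f p.
Proof. by move=> sf Up; rewrite spatial_ebasis (derive_dir_sum oU _ _ sf Up). Qed.

Lemma hess_entryE f i j :
  (fun q => hess f q i j) = 'D_(spatial (ebasis R i)) ('D_(spatial (ebasis R j)) f).
Proof. by apply/funext => q; rewrite mxE. Qed.

Lemma smooth_on_hess f i j : smooth_on U f -> smooth_on U (fun q => hess f q i j).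
Proof.
by move=> sf; rewrite hess_entryE; apply: smooth_on_derive; exact: smooth_on_derive.
Qed.

Lemma bform_hess f p v w : smooth_on U f -> U p ->
  bform (hess f p) v w = 'D_(spatial v) ('D_(spatial w) f) p.
Proof.
move=> sf Up; rewrite bformE (derive_spatial v (smooth_on_derive (spatial w) sf) Up).
apply: eq_bigr => i _.
(* Linearity in the direction is available for the outermost derivative, so the two derivatives are
   exchanged before [w] is expanded, and exchanged back afterwards. *)
rewrite (derive_comm oU (spatial (ebasis R i)) (spatial w) sf Up).
rewrite (derive_spatial w (smooth_on_derive _ sf) Up) mulr_sumr.
apply: eq_bigr => j _; rewrite mxE -mulrA /=.
by rewrite (derive_comm oU (spatial (ebasis R i)) (spatial (ebasis R j)) sf Up).
Qed.

Lemma hess_sym f p : smooth_on U f -> U p -> (hess f p)^T = hess f p.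
Proof.
move=> sf Up; apply/matrixP => i j; rewrite !mxE.
exact: (derive_comm oU _ _ sf Up).
Qed.

Lemma derive_second_order p v (lam : R) : U p -> bform (hess u p) v v = lam * sqnorm v ->
  (forall m, \forall h \near 0^'+, forall xi,
    lam * sqnorm xi <= bform (hess u (p + h *: spatial m)) xi xi /\
    lam * sqnorm xi <= bform (hess u (p - h *: spatial m)) xi xi) ->
  forall m e, 2 * (lam * sqnorm e) <=
    'D_(spatial m) ('D_(spatial m) ('D_(spatial v) ('D_(spatial v) u))) p +
    2 * (2 * 'D_(spatial m) ('D_(spatial e) ('D_(spatial v) u)) p) +
    2 * 'D_(spatial e) ('D_(spatial e) u) p.
Proof.
move=> Up eqv Hlam m e.
have sv := smooth_on_derive (spatial v) su.
(* The coefficients are [D_v D_v u], [D_e D_v u] and [D_e D_e u]: those of the Hessian form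
   evaluated at [v + h *: e] and [v - h *: e]. *)
apply: (@second_order_le _ _ U oU _ _ _ p (spatial m) _ (smooth_on_derive (spatial v) sv)
  (smooth_on_derive (spatial e) sv)
  (smooth_on_derive (spatial e) (smooth_on_derive (spatial e) su)) Up).
near=> h.
have h0 : 0 < h by near: h; exact: nbhs_right_gt.
have [Uh UNh] : U (p + h *: spatial m) /\ U (p - h *: spatial m).
  by near: h; apply: near_line; move: oU; rewrite openE; apply.
have Hl : forall xi,
    lam * sqnorm xi <= bform (hess u (p + h *: spatial m)) xi xi /\
    lam * sqnorm xi <= bform (hess u (p - h *: spatial m)) xi xi by near: h; exact: Hlam.
have H1 := (Hl (v + h *: e)).1; have H2 := (Hl (v - h *: e)).2.
have S1 := hess_sym su Uh; have S2 := hess_sym su UNh.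
(* Rewriting with equations between iterated derivatives makes unification unfold
   [derive] and diverge, so such equations are passed as arguments. *)
have subst_eqs (a1 a2 a3 b1 b2 c1 c2 A1 A2 A3 B1 B2 C1 C2 : R) :
    A1 = a1 -> A2 = a2 -> A3 = a3 -> B1 = b1 -> B2 = b2 -> C1 = c1 -> C2 = c2 ->
    2 * A1 + h ^+ 2 * (2 * (lam * sqnorm e)) <=
      A2 + A3 + 2 * h * (B1 - B2) + h ^+ 2 * (C1 + C2) ->
    2 * a1 + h ^+ 2 * (2 * (lam * sqnorm e)) <=
      a2 + a3 + 2 * h * (b1 - b2) + h ^+ 2 * (c1 + c2).
  by move=> -> -> -> -> -> -> ->.
apply: (subst_eqs _ _ _ _ _ _ _ _ _ _ _ _ _ _
  (etrans (esym eqv) (bform_hess v v su Up)) (bform_hess v v su Uh) (bform_hess v v su UNh)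
  (bform_hess e v su Uh) (bform_hess e v su UNh)
  (bform_hess e e su Uh) (bform_hess e e su UNh)).
exact: (bform_perturbation S1 S2 H1 H2).
Unshelve. all: by end_near. Qed.
End Hessian.

Section Line.
Variables (R : realType) (n : nat).

(** [P h] and [N h] stand for the Hessians at opposite points of a line through a point with Hessian
    [A]. The conclusion is the hypothesis of [le_harmonic_mean], with a loss of order [h ^+ 2]. *)
Lemma near_forms_line (P N : R -> 'M[R]_n) (A X Y : 'M[R]_n) (lam kap : R) :
  (forall i j, (P h i j + N h i j - 2 * A i j) / h ^+ 2 @[h --> 0^'+] --> X i j) ->
  (forall i j, (P h i j - N h i j) / h @[h --> 0^'+] --> Y i j) ->
  (forall i j, P h i j + N h i j @[h --> 0^'+] --> 2 * A i j) ->
  (\forall h \near 0^'+, (P h)^T = P h /\ (N h)^T = N h) ->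
  0 < lam -> 0 < kap ->
  (forall m e, 2 * (lam * sqnorm e) <=
     bform X m m + 2 * bform Y m e + 2 * bform A e e) ->
  \forall h \near 0^'+, forall m d,
    2 * bform (A - (kap * h ^+ 2)%:M) m m <=
    bform (P h) (m + d) (m + d) + bform (N h) (m - d) (m - d).
Proof.
move=> cX cY cZ sPN l0 k0 H.
pose Xh h := \matrix_(i, j) ((P h i j + N h i j - 2 * A i j) / h ^+ 2).
pose Yh h := \matrix_(i, j) (2 * ((P h i j - N h i j) / h)).
pose Zh h := \matrix_(i, j) (P h i j + N h i j).
have cX' i j : Xh h i j @[h --> 0^'+] --> X i j.
  by under eq_fun do rewrite mxE; exact: cX.
have cY' i j : Yh h i j @[h --> 0^'+] --> (2 *: Y) i j.
  by under eq_fun do rewrite mxE; rewrite mxE; apply: cvgM; [exact: cvg_cst|exact: cY].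
have cZ' i j : Zh h i j @[h --> 0^'+] --> (2 *: A) i j.
  by under eq_fun do rewrite mxE; rewrite mxE; exact: cZ.
have l2 : 0 < 2 * lam by rewrite mulr_gt0.
have k2 : 0 < 2 * kap by rewrite mulr_gt0.
have F : \forall h \near 0^'+, forall m e,
    - (2 * kap) * sqnorm m <= bform (Xh h) m m + bform (Yh h) m e + bform (Zh h) e e.
  apply: (near_forms_ge cX' cY' cZ' l2 k2) => m e.
  by rewrite !bformZ -mulrA; exact: H.
near=> h => m d.
have h0 : 0 < h by near: h; exact: nbhs_right_gt.
have [SP SN] : (P h)^T = P h /\ (N h)^T = N h by near: h.
have Fh : forall m e, - (2 * kap) * sqnorm m <=
    bform (Xh h) m m + bform (Yh h) m e + bform (Zh h) e e by near: h.
have hn0 : h != 0 by rewrite gt_eqF.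
have XE : Xh h = (h ^+ 2)^-1 *: (P h + N h - 2 *: A).
  by apply/matrixP => i j; rewrite !mxE mulrC.
have YE : Yh h = (2 / h) *: (P h - N h).
  by apply/matrixP => i j; rewrite !mxE mulrAC mulrA.
have ZE : Zh h = P h + N h by apply/matrixP => i j; rewrite !mxE.
(* Rescaling [e = d / h] and multiplying by [h ^+ 2] removes all the denominators. *)
have := Fh m (h^-1 *: d); rewrite XE YE ZE -(ler_pM2l (exprn_gt0 2 h0)).
rewrite !(bformZ, bformD, bformN, bformZl, bformZr, bform_scalar).
rewrite !(bformDl, bformDr, bformNl, bformNr).
rewrite (bform_sym d m SP) (bform_sym d m SN).
move: (bform (P h) m m) (bform (N h) m m) (bform (P h) m d) (bform (N h) m d)
  (bform (P h) d d) (bform (N h) d d) (sqnorm m) (bform A m m).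
move=> q1 q2 q3 q4 q5 q6 q7 q8.
rewrite [X in _ <= X -> _](_ : _ = q1 + q2 - 2 * q8 + 2 * (q3 - q4) + (q5 + q6)).
  by lra.
by field.
Unshelve. all: by end_near. Qed.

Variables (U : set ('rV[R]_n * R)) (u : 'rV[R]_n * R -> R).
Hypotheses (oU : open U) (su : smooth_on U u).

(** Since derivatives commute, the limits are Hessians again: that of [D_v D_v u], and twice that of
    [D_v u]. *)
Lemma hess_expansion p (v : 'rV[R]_n) : U p -> exists X Y : 'M[R]_n,
  [/\ forall i j, (hess u (p + h *: spatial v) i j + hess u (p - h *: spatial v) i j -
        2 * hess u p i j) / h ^+ 2 @[h --> 0^'+] --> X i j,
      forall i j, (hess u (p + h *: spatial v) i j - hess u (p - h *: spatial v) i j) / h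
        @[h --> 0^'+] --> Y i j,
      forall i j, hess u (p + h *: spatial v) i j + hess u (p - h *: spatial v) i j
        @[h --> 0^'+] --> 2 * hess u p i j,
      forall m, bform X m m = 'D_(spatial m) ('D_(spatial m) ('D_(spatial v) ('D_(spatial v) u))) p
    & forall m e, bform Y m e = 2 * 'D_(spatial m) ('D_(spatial e) ('D_(spatial v) u)) p].
Proof.
move=> Up.
have sv := smooth_on_derive (spatial v) su.
have cvg_eq (G : set_system R) (a b : R) : a = b -> G --> a -> G --> b by move=> ->.
have sij i j := smooth_on_hess i j su.
exists (hess ('D_(spatial v) ('D_(spatial v) u)) p), (2 *: hess ('D_(spatial v) u) p); split.
- move=> i j; apply: cvg_eq (@second_difference _ _ U oU _ p (spatial v) (sij i j) Up).
  apply: (etrans (congr1 (fun f => 'D_(spatial v) ('D_(spatial v) f) p) (hess_entryE u i j))).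
  apply: (etrans (@derive_comm4 _ _ U oU u p _ _ _ su Up)).
  by rewrite mxE.
- move=> i j; apply: cvg_eq (@symmetric_difference _ _ U _ p (spatial v) (sij i j) Up).
  rewrite mxE; apply: (congr1 (fun x : R => 2 * x)).
  apply: (etrans (congr1 (fun f => 'D_(spatial v) f p) (hess_entryE u i j))).
  apply: (etrans (@derive_comm3 _ _ U oU u p _ _ _ su Up)).
  by rewrite mxE.
- move=> i j; apply: cvg_eq (@symmetric_sum _ _ U oU _ p (spatial v) (sij i j) Up).
  by [].
- move=> m; exact: (bform_hess oU m m (smooth_on_derive (spatial v) sv) Up).
- move=> m e; apply: (etrans (bformZ _ _ _ _)).
  apply: (congr1 (fun x : R => 2 * x)); exact: (bform_hess oU m e sv Up).
Qed.
End Line.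

(** * The sign of the second derivative of F(D^2u) at the minimum *)

Lemma near_right_sq (R : realType) (c : R) (P : set R) : 0 < c ->
  (\forall k \near 0^'+, P k) -> \forall h \near 0^'+, P (c * h ^+ 2).
Proof.
move=> c0 [r /= r0 Hr]; near=> h.
have h0 : 0 < h by near: h; exact: nbhs_right_gt.
have h1 : h < 1 by near: h; exact: nbhs_right_lt.
have hr : h < r / c by near: h; apply: nbhs_right_lt; rewrite divr_gt0.
have ch0 : 0 < c * h ^+ 2 by rewrite mulr_gt0// exprn_gt0.
apply: Hr => //=; rewrite sub0r normrN gtr0_norm//.
rewrite ltr_pdivlMr// in hr; rewrite (le_lt_trans _ hr)// expr2 mulrA [c * h]mulrC.
by rewrite ler_piMr ?ltW// mulr_gt0.
Unshelve. all: by end_near. Qed.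

Section Concavity.
Variables (R : realType) (n : nat) (U : set ('rV[R]_n * R)) (u : 'rV[R]_n * R -> R).
Variable F : 'M[R]_n -> R.
Hypotheses (oU : open U) (su : smooth_on U u).
Hypothesis Fmono : forall A B : 'M[R]_n, posdef A -> posdef B -> F A <= F (A + B).
Hypothesis Fconc : concave_on (@posdef R n) (Fstar F).

(** [f] stands for the time derivative of [u]. It agrees with F(D^2u) at [p] and at the nearby
    points of the line, so its second difference is estimated through [F] at three Hessians. *)
Lemma derive2_F_hess_ge0 p (v : 'rV[R]_n) (lam : R) f :
  smooth_on U f -> U p -> 0 < lam ->
  (forall xi, lam * sqnorm xi <= bform (hess u p) xi xi) ->
  bform (hess u p) v v = lam * sqnorm v ->
  (forall m, \forall h \near 0^'+, forall xi,
    lam * sqnorm xi <= bform (hess u (p + h *: spatial m)) xi xi /\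
    lam * sqnorm xi <= bform (hess u (p - h *: spatial m)) xi xi) ->
  f p = F (hess u p) ->
  (\forall h \near 0^'+,
    (posdef (hess u (p + h *: spatial v)) /\
       f (p + h *: spatial v) = F (hess u (p + h *: spatial v))) /\
    (posdef (hess u (p - h *: spatial v)) /\
       f (p - h *: spatial v) = F (hess u (p - h *: spatial v)))) ->
  derivable F (hess u p) (- 1%:M) ->
  0 <= 'D_(spatial v) ('D_(spatial v) f) p.
Proof.
move=> sf Up lam0 lamA eqv Hlam fp fpm dF.
pose M := 'D_(- 1%:M) F (hess u p).
(* The added 1 makes [- C < M] strict, so the difference quotients of [F] along [- 1%:M] eventually
   exceed [- C]. *)
pose C := `|M| + 1.
have C0 : 0 < C by rewrite ltr_wpDl.
have FC : \forall k \near 0^'+, - C * k <= F (hess u p + k *: (- 1%:M)) - F (hess u p).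
  have MC : - C < M.
    by rewrite /C ltrNl (le_lt_trans (ler_norm _))// normrN ltrDl.
  near=> k.
  have k0 : 0 < k by near: k; exact: nbhs_right_gt.
  have : - C < (F (hess u p + k *: (- 1%:M)) - F (hess u p)) / k.
    by near: k; exact: (cvgr_gt M (difference_quotient dF) _ MC).
  by rewrite ltr_pdivlMr// => /ltW.
suff H : forall kap, 0 < kap -> - (4 * kap * C) <= 'D_(spatial v) ('D_(spatial v) f) p.
  rewrite leNgt; apply/negP => D0.
  move: H D0; move: ('D_(spatial v) _ p) => D H D0.
  (* For this [kap] the lower bound equals [D / 2], which exceeds [D] when [D] is negative. *)
  have := H (- D / (8 * C)); rewrite divr_gt0 ?mulr_gt0 ?oppr_gt0// => /(_ isT).
  have -> : 4 * (- D / (8 * C)) * C = - D / 2 by field; rewrite gt_eqF.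
  lra.
move=> kap kap0.
have [X [Y [cX cY cZ XE YE]]] := hess_expansion oU su v Up.
have Hforms : \forall h \near 0^'+, forall m d,
    2 * bform (hess u p - (kap * h ^+ 2)%:M) m m <=
    bform (hess u (p + h *: spatial v)) (m + d) (m + d) +
    bform (hess u (p - h *: spatial v)) (m - d) (m - d).
  apply: (near_forms_line cX cY cZ) lam0 kap0 _.
    near=> h.
    have [[p1 _] [p2 _]] : (posdef (hess u (p + h *: spatial v)) /\
       f (p + h *: spatial v) = F (hess u (p + h *: spatial v))) /\
    (posdef (hess u (p - h *: spatial v)) /\
       f (p - h *: spatial v) = F (hess u (p - h *: spatial v))) by near: h.
    by split; [exact: p1.1|exact: p2.1].
  move=> m e.
  have subst_eqs (a b c A B D : R) : A = a -> B = 2 * b -> D = c ->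
      2 * (lam * sqnorm e) <= a + 2 * (2 * b) + 2 * c ->
      2 * (lam * sqnorm e) <= A + 2 * B + 2 * D by move=> -> -> ->.
  apply: (subst_eqs _ _ _ _ _ _ (XE m) (YE m e) (bform_hess oU e e su Up)).
  exact: (derive_second_order oU su Up eqv Hlam).
apply: (cvgr_to_ge (@second_difference _ _ U oU f p (spatial v) sf Up)).
have kap2 : 0 < 2 * kap by rewrite mulr_gt0.
near=> h.
have h0 : 0 < h by near: h; exact: nbhs_right_gt.
have h2 : 0 < h ^+ 2 by rewrite exprn_gt0.
have [[p1 f1] [p2 f2]] : (posdef (hess u (p + h *: spatial v)) /\
       f (p + h *: spatial v) = F (hess u (p + h *: spatial v))) /\
    (posdef (hess u (p - h *: spatial v)) /\
       f (p - h *: spatial v) = F (hess u (p - h *: spatial v))) by near: h.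
(* As [lam] bounds the Hessian at [p] from below, the matrix shifted by this amount stays in the
   positive cone. *)
have hlam : 2 * kap * h ^+ 2 < lam.
  by near: h; apply: (near_right_sq (P := fun k => k < lam)) => //; exact: nbhs_right_lt.
have FCh : - C * (2 * kap * h ^+ 2) <=
    F (hess u p + (2 * kap * h ^+ 2) *: (- 1%:M)) - F (hess u p).
  near: h; exact: (near_right_sq
    (P := fun k => - C * k <= F (hess u p + k *: (- 1%:M)) - F (hess u p))).
have Hf : forall m d,
    2 * bform (hess u p - (kap * h ^+ 2)%:M) m m <=
    bform (hess u (p + h *: spatial v)) (m + d) (m + d) +
    bform (hess u (p - h *: spatial v)) (m - d) (m - d) by near: h.
(* One shift by [kap * h ^+ 2] comes from [near_forms_line], the other from the strict increment in
   [harmonic_mean_F_le]. *)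
have sE : hess u p - (kap * h ^+ 2)%:M - (kap * h ^+ 2)%:M =
    hess u p + (2 * kap * h ^+ 2) *: (- 1%:M).
  rewrite -addrA; congr (_ + _); apply/matrixP => i j; rewrite !mxE.
  by case: (i == j); rewrite ?mulr1n ?mulr0n; ring.
have pE : posdef (hess u p - (kap * h ^+ 2)%:M - (kap * h ^+ 2)%:M).
  rewrite sE; split.
    by rewrite linearD linearZ /= linearN /= trmx1 (hess_sym oU su Up).
  move=> w w0; rewrite -/(bform _ _ _) bformD bformZ bformN bform_scalar mul1r.
  by rewrite mulrN subr_gt0 (lt_le_trans _ (lamA w))// ltr_pM2r// sqnorm_gt0.
have kh0 : 0 < kap * h ^+ 2 by rewrite mulr_gt0.
have HF := harmonic_mean_F_le Fmono Fconc p1 p2 kh0 pE Hf.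
have arith (x a b c x' a' b' c' : R) : a = a' -> b = b' -> c = c' -> x' = x ->
    - C * (2 * kap * h ^+ 2) <= x - c' -> 2 * x' <= a' + b' ->
    - (4 * kap * C) * h ^+ 2 <= a + b - 2 * c.
  by move=> -> -> -> ->; clear; lra.
by rewrite ler_pdivlMr//; exact: (arith _ _ _ _ _ _ _ _ f1 f2 fp (congr1 F sE) FCh HF).
Unshelve. all: by end_near. Qed.
End Concavity.

(** * The minimum of the smallest eigenvalue *)

Lemma cvg_bform (R : realType) (n : nat) (T : Type) (G : set_system T) {FG : Filter G}
    (A : T -> 'M[R]_n) (v w : T -> 'rV[R]_n) (A0 : 'M[R]_n) (v0 w0 : 'rV[R]_n) :
  (forall i j, A z i j @[z --> G] --> A0 i j) ->
  (forall i, v z 0 i @[z --> G] --> v0 0 i) ->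
  (forall i, w z 0 i @[z --> G] --> w0 0 i) ->
  bform (A z) (v z) (w z) @[z --> G] --> bform A0 v0 w0.
Proof.
move=> cA cv cw; rewrite bformE; under eq_fun do rewrite bformE.
apply: cvg_big; first exact: add_continuous.
move=> i _; apply: cvg_big; first exact: add_continuous.
by move=> j _; apply: cvgM; [apply: cvgM|].
Qed.

Section Compactness.
Variables (R : realType) (n : nat).

(** The norm on row vectors is the largest absolute entry, and the square of each entry is at most
    the sum of squares. *)
Lemma compact_sphere : compact [set v : 'rV[R]_n | sqnorm v = 1].
Proof.
apply: bounded_closed_compact.
  exists 1; split; first exact: real1.
  move=> M M1 v /= v1; rewrite (le_trans _ (ltW M1))// [leLHS]mx_normrE.
  apply: bigmax_le => // -[i j] _ /=; rewrite (ord1 i).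
  rewrite -(@ler_pXn2r _ 2)// ?nnegrE// expr1n -v1 sqnormE (bigD1 j)//=.
  by rewrite real_normK ?num_real// lerDl sumr_ge0// => k _; exact: sqr_ge0.
apply: (@preimage_closed _ _ (@sqnorm R n) [set 1]); last exact: closed_eq.
move=> v _; apply: (@cvg_bform _ _ _ (nbhs v) _ (fun=> 1%:M) id id 1%:M v v).
- by move=> i j; exact: cvg_cst.
- by move=> i; exact: coord_continuous.
- by move=> i; exact: coord_continuous.
Qed.

Lemma compact_closure_bounded (A : set 'rV[R]_n) : bounded_set A -> compact (closure A).
Proof.
move=> [M [Mreal HM]]; apply: bounded_closed_compact; last exact: closed_closure.
exists M; split => // N MN x Ax /=.
have cD : closed ((fun y : 'rV[R]_n => `|y|) @^-1` [set r | r <= N]).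
  by apply: preimage_closed; [move=> y _; exact: norm_continuous|exact: closed_le].
by apply: cD; apply: closureS Ax => y Ay; exact: HM.
Qed.
End Compactness.

Lemma sqnorm_normalize (R : realType) (n : nat) (v : 'rV[R]_n) : v != 0 ->
  sqnorm ((Num.sqrt (sqnorm v))^-1 *: v) = 1.
Proof.
rewrite -sqnorm_gt0 => v0; rewrite {1}/sqnorm bformZl bformZr -/(sqnorm v) mulrA.
by rewrite -invfM -expr2 (sqr_sqrtr (ltW v0)) mulVf// gt_eqF.
Qed.

Lemma bform_normalize (R : realType) (n : nat) (A : 'M[R]_n) (v : 'rV[R]_n) (c : R) :
  v != 0 -> let w := (Num.sqrt (sqnorm v))^-1 *: v in
  (c <= bform A w w) = (c * sqnorm v <= bform A v v).
Proof.
rewrite -sqnorm_gt0 => v0 /=; rewrite bformZl bformZr mulrA.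
by rewrite -invfM -expr2 (sqr_sqrtr (ltW v0)) [_^-1 * _]mulrC ler_pdivlMr.
Qed.

Section Minimum.
Variables (R : realType) (n : nat) (Omega : set 'rV[R]_n).
Variables (u : 'rV[R]_n * R -> R) (U : set ('rV[R]_n * R)) (T : R).
Hypotheses (bOmega : bounded_set Omega) (oU : open U) (su : smooth_on U u).
Hypothesis KU : forall x t, closure Omega x -> 0 <= t <= T -> U (x, t).

(** Extreme value theorem on the product of the closure, the time interval and the unit sphere; the
    given point shows that this product is nonempty. *)
Lemma min_hess (delta : R) (x1 : 'rV[R]_n) (t1 : R) (v1 : 'rV[R]_n) :
  closure Omega x1 -> 0 <= t1 <= T -> sqnorm v1 = 1 ->
  exists (x0 : 'rV[R]_n) (t0 : R) (v0 : 'rV[R]_n), [/\ closure Omega x0,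
    0 <= t0 <= T, sqnorm v0 = 1 &
    forall (x : 'rV[R]_n) (t : R) (v : 'rV[R]_n),
      closure Omega x -> 0 <= t <= T -> sqnorm v = 1 ->
      bform (hess u (x0, t0)) v0 v0 + delta * t0 <=
      bform (hess u (x, t)) v v + delta * t].
Proof.
move=> Ox1 t1T v11.
pose S := [set v : 'rV[R]_n | sqnorm v = 1].
pose K : set ('rV[R]_n * R * 'rV[R]_n) := (closure Omega `*` [set t | 0 <= t <= T]) `*` S.
pose psi (z : 'rV[R]_n * R * 'rV[R]_n) := bform (hess u z.1) z.2 z.2 + delta * z.1.2.
have cK : compact K.
  apply: compact_setX; last exact: compact_sphere.
  apply: compact_setX; first exact: compact_closure_bounded.
  exact: (@segment_compact R 0 T).
have K0 : K !=set0 by exists ((x1, t1), v1).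
have cpsi : {within K, continuous psi}.
  apply: continuous_in_subspaceT => -[[x t] v]; rewrite inE => -[[/= Ox tT] _].
  have cfst : z.1 @[z --> ((x, t), v)] --> (x, t) by exact: cvg_fst.
  have csnd : z.2 @[z --> ((x, t), v)] --> v by exact: cvg_snd.
  apply: cvgD.
    apply: (@cvg_bform _ _ _ (nbhs ((x, t), v)) _ (fun z => hess u z.1) snd snd
      (hess u (x, t)) v v).
    - move=> i j.
      apply: (@cvg_comp _ _ _ fst (fun q => hess u q i j) _ (nbhs (x, t))) => //.
      exact: (smooth_on_continuous oU (smooth_on_hess i j su) (KU Ox tT)).
    - move=> i; apply: (@cvg_comp _ _ _ snd (fun w : 'rV[R]_n => w 0 i) _ (nbhs v)) => //.
      exact: coord_continuous.
    - move=> i; apply: (@cvg_comp _ _ _ snd (fun w : 'rV[R]_n => w 0 i) _ (nbhs v)) => //.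
      exact: coord_continuous.
  apply: cvgM; first exact: cvg_cst.
  by apply: (@cvg_comp _ _ _ fst snd _ (nbhs (x, t))) => //; exact: cvg_snd.
have [[[x0 t0] v0]] := compact_EVT_min K0 cK cpsi.
rewrite inE => -[[/= Ox0 t0T] Sv0] Hmin.
exists x0, t0, v0; split => // x t v Ox tT Sv.
by apply: (Hmin ((x, t), v)); rewrite inE.
Qed.
End Minimum.

(** * Contradiction at the minimum point *)

Theorem theorem3p3 (R : realType) (n : nat) (Omega : set 'rV[R]_n)
  (F : 'M[R]_n -> R) (u : 'rV[R]_n * R -> R) (T eps : R) :
  (* Omega is a bounded domain *)
  open Omega -> connected Omega -> Omega !=set0 -> bounded_set Omega ->
  (* F is C^2 on the cone of positive definite symmetric matrices *)
  Ck_on 2 (@symmat R n) (@posdef R n) F ->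
  (* F is monotone increasing *)
  (forall A B : 'M[R]_n, posdef A -> posdef B -> F A <= F (A + B)) ->
  (* F^*(A) = -F(A^{-1}) is concave on the cone *)
  concave_on (@posdef R n) (Fstar F) ->
  (* u is smooth on (a neighbourhood of) closure(Omega) x [0,T] *)
  (exists U : set ('rV[R]_n * R), open U /\
     (forall x t, closure Omega x -> 0 <= t <= T -> U (x, t)) /\ smooth_on U u) ->
  (* u solves du/dt = F(D^2 u) *)
  (forall x t, Omega x -> 0 <= t <= T ->
     posdef (hess u (x, t)) /\ dt u (x, t) = F (hess u (x, t))) ->
  0 < eps ->
  (forall x, Omega x -> mx_ge (hess u (x, 0)) eps%:M) ->
  (forall x t, closure Omega x -> ~ Omega x -> 0 <= t <= T ->
     mx_ge (hess u (x, t)) eps%:M) ->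
  forall x t, Omega x -> 0 <= t <= T -> mx_ge (hess u (x, t)) eps%:M.
Proof.
move=> oOmega _ _ bOmega FC2 Fmono Fconc [U [oU [KU su]]] pde eps0 init bdry.
move=> x1 t1 Ox1 /[dup] t1T /andP[t1ge0 t1leT] v1; rewrite -!/(bform _ _ _) bform_scalar.
rewrite leNgt; apply/negP => Hlt.
have v1n0 : v1 != 0.
  apply/eqP => v10; move: Hlt.
  by rewrite v10 /sqnorm !bform0l mulr0 ltxx.
pose w1 := (Num.sqrt (sqnorm v1))^-1 *: v1.
have w11 : sqnorm w1 = 1 by exact: sqnorm_normalize.
have {}Hlt : bform (hess u (x1, t1)) w1 w1 < eps.
  by rewrite ltNge bform_normalize// -ltNge.
have T0 : 0 <= T by exact: le_trans t1leT.
(* Since [t1] is smaller than [2 * (T + 1)], the penalty [delta * t1] does not use up the gap below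
   [eps]. *)
pose delta := (eps - bform (hess u (x1, t1)) w1 w1) / (2 * (T + 1)).
have T1 : 0 < 2 * (T + 1) by lra.
have delta0 : 0 < delta by rewrite divr_gt0// subr_gt0.
have deltat1 : bform (hess u (x1, t1)) w1 w1 + delta * t1 < eps.
  rewrite -ltrBrDl /delta mulrAC ltr_pdivrMr// ltr_pM2l ?subr_gt0//; lra.
have cO1 : closure Omega x1 by exact: subset_closure.
have [x0 [t0 [v0 [cO0 t0T v01 Hmin]]]] := min_hess bOmega oU su KU delta cO1 t1T w11.
have lt_eps : bform (hess u (x0, t0)) v0 v0 + delta * t0 < eps.
  by apply: le_lt_trans deltat1; exact: Hmin.
have /andP[t0ge0 t0leT] := t0T.
have delta_t0 : 0 <= delta * t0 by rewrite mulr_ge0// ltW.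
(* The bound fails at the minimum point, so this point lies neither on the lateral boundary nor at
   the initial time. *)
have notge : ~ mx_ge (hess u (x0, t0)) eps%:M.
  move=> /(_ v0); rewrite -!/(bform _ _ _) bform_scalar v01 mulr1.
  by move: lt_eps delta_t0; move: (bform _ _ _) => b; lra.
have O0 : Omega x0 by apply: contrapT => nO0; apply: notge; exact: bdry.
have t0gt0 : 0 < t0.
  rewrite lt_neqAle t0ge0 andbT; apply/eqP => t00.
  by apply: notge; rewrite -t00; exact: init.
have v0n0 : v0 != 0 by rewrite -sqnorm_gt0 v01.
pose lam := bform (hess u (x0, t0)) v0 v0.
have lam0 : 0 < lam.
  by apply: posdef_bform_gt0 => //; exact: (pde _ _ O0 t0T).1.
(* At the common time [t0] the penalties cancel, so [lam] is a lower bound for the eigenvalues on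
   the whole time slice. *)
have lam_le x xi : closure Omega x -> lam * sqnorm xi <= bform (hess u (x, t0)) xi xi.
  move=> cOx; have [->|xi0] := eqVneq xi 0.
    by rewrite /sqnorm !bform0l mulr0.
  rewrite -bform_normalize//.
  have := Hmin x t0 _ cOx t0T (sqnorm_normalize xi0).
  by rewrite lerD2r.
have Up : U (x0, t0) by exact: KU.
have lineE (m : 'rV[R]_n) (h : R) : ((x0, t0) + h *: spatial m = (x0 + h *: m, t0)) /\
    ((x0, t0) - h *: spatial m = (x0 - h *: m, t0)).
  by split; rewrite -?scaleNr; congr (_, _); rewrite /= scaler0 addr0.
have nearO (m : 'rV[R]_n) : \forall h \near 0^'+, Omega (x0 + h *: m) /\ Omega (x0 - h *: m).
  by apply: near_line; move: oOmega; rewrite openE; apply.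
have svv := smooth_on_derive (spatial v0) (smooth_on_derive (spatial v0) su).
(* Comparison with [(x0, t0 - h)] and the same vector [v0]: the penalty drops by [delta * h], so the
   Hessian form must rise by at least as much. *)
have neg : 'D_((0 : 'rV[R]_n), (1 : R)) ('D_(spatial v0) ('D_(spatial v0) u)) (x0, t0) <= - delta.
  apply: (derive_le_backward svv Up).
  near=> h.
  have h0 : 0 < h by near: h; exact: nbhs_right_gt.
  have ht0 : h <= t0 by near: h; exact: nbhs_right_le.
  have backE : (x0, t0) - h *: ((0 : 'rV[R]_n), (1 : R)) = (x0, t0 - h).
    have E1 : x0 - h *: 0 = x0 by rewrite scaler0 subr0.
    have E2 : t0 - h *: (1 : R) = t0 - h by rewrite [h *: _]mulr1.
    by rewrite -[in RHS]E1 -[in RHS]E2.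
  have thT : 0 <= t0 - h <= T.
    by rewrite subr_ge0 ht0 (le_trans _ t0leT)// gerBl ltW.
  have Uh := KU _ _ cO0 thT.
  have diff_le : delta * h <= bform (hess u (x0, t0 - h)) v0 v0 - bform (hess u (x0, t0)) v0 v0.
    have arith (a b : R) : b + delta * t0 <= a + delta * (t0 - h) -> delta * h <= a - b.
      by clear; lra.
    exact: (arith _ _ (Hmin x0 (t0 - h) v0 cO0 thT v01)).
  have E1 := bform_hess oU v0 v0 su Up; have E2 := bform_hess oU v0 v0 su Uh.
  have subst_eqs (a b c d : R) : c = a -> d = b -> delta * h <= c - d ->
    delta * h <= a - b by move=> -> ->.
  rewrite backE.
  exact: (subst_eqs _ _ _ _ E2 E1 diff_le).
have sdt : smooth_on U (dt u) := smooth_on_derive _ su.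
have F1 := @derive2_F_hess_ge0 R n U u F oU su Fmono Fconc (x0, t0) v0 lam (dt u) sdt Up lam0.
have ge0 : 0 <= 'D_(spatial v0) ('D_(spatial v0) (dt u)) (x0, t0).
  apply: F1.
  - by move=> xi; exact: lam_le.
  - by rewrite v01 mulr1.
  - move=> m; near=> h => xi; rewrite (lineE m h).1 (lineE m h).2.
    have [xO1 xO2] : Omega (x0 + h *: m) /\ Omega (x0 - h *: m) by near: h.
    by split; apply: lam_le; exact: subset_closure.
  - exact: (pde _ _ O0 t0T).2.
  - near=> h; rewrite (lineE v0 h).1 (lineE v0 h).2.
    have [xO1 xO2] : Omega (x0 + h *: v0) /\ Omega (x0 - h *: v0) by near: h.
    by split; exact: pde.
  - have [|v|+ _] := FC2 [::]; [by []|by []|].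
    move=> /(_ _ (pde _ _ O0 t0T).1 (- 1%:M)); apply => //.
    by rewrite /symmat /= linearN /= trmx1.
have commE := @derive_comm3 R _ U oU u (x0, t0) (0, 1) (spatial v0) (spatial v0) su Up.
(* Both signs concern the same number, since the time derivative commutes with the two derivatives
   along [v0]. *)
have sign (a b : R) : a = b -> 0 <= b -> a <= - delta -> False.
  by move=> -> b0 /(le_trans b0); rewrite oppr_ge0 leNgt delta0.
exact: (sign _ _ commE ge0 neg).
Unshelve. all: by end_near. Qed.
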